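(* Let $G$ be a Lie group modelled on a locally convex space $E$ whose underlying topological space is a $k_\omega$-space. Then $G$ is Weil complete.
   Context: A $k_\omega$-space is a Hausdorff topological space $X$ for which there is an ascending sequence $K_1\subseteq K_2\subseteq\cdots$ of compact subsets $K_n\subseteq X$ with $\bigcup_{n\in\mathbb{N}}K_n=X$ such that $X$ carries the direct limit topology, i.e., a subset $A\subseteq X$ is closed if and only if $A\cap K_n$ is closed in $K_n$ for each $n\in\mathbb{N}$. A topological group is called Weil complete if it is complete in its left uniformity, i.e., every Cauchy net (or Cauchy filter) with respect to the left uniform structure converges. Locally convex spaces are real or complex Hausdorff locally convex topological vector spaces. Smoothness is understood in the sense of Keller's $C^\infty_c$-theory: for locally convex spaces $E,F$ over $\mathbb{K}\in\{\mathbb{R},\mathbb{C}\}$ and $U\subseteq E$ open, a map $f\colon U\to F$ is $C^\infty$ if it is continuous and, for each $k\in\mathbb{N}$, the iterated directional derivatives $d^{(k)}f(x,y_1,\ldots,y_k)=(D_{y_k}\cdots D_{y_1}f)(x)$ (over $\mathbb{K}$) exist for all $x\in U$, $y_1,\ldots,y_k\in E$ and define continuous maps $d^{(k)}f\colon U\times E^k\to F$. A Lie group modelled on $E$ is a group $G$ endowed with a smooth manifold structure modelled on $E$ (with Hausdorff underlying topology, charts being homeomorphisms onto open subsets of $E$ with smooth transition maps) such that the group multiplication and inversion are smooth; in particular, $G$ is a Hausdorff topological group. *)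

(* Defs.v *)
From HB Require Import structures.
From mathcomp Require Import all_boot all_order all_algebra.
From mathcomp Require Import all_classical all_reals all_analysis.
From mathcomp.real_closed Require Import complex.

Set Implicit Arguments.
Unset Strict Implicit.
Unset Printing Implicit Defensive.

Import Order.TTheory GRing.Theory Num.Theory.
Import numFieldNormedType.Exports.

Local Open Scope classical_set_scope.
Local Open Scope ring_scope.

Variant scalar_kind := RealScalars | ComplexScalars.

Definition scalars (R : realType) (s : scalar_kind) : numFieldType :=
  match s with
  | RealScalars => R
  | ComplexScalars => complex R
  end.

Definition komega_space (X : topologicalType) : Prop :=
  hausdorff_space X /\
  exists K : nat -> set X,
    [/\ forall n, compact (K n),
        forall n, K n `<=` K n.+1,
        \bigcup_n K n = setT
      & forall A : set X,
          closed A <-> forall n, closed (A `&` K n : set (subspace (K n)))].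

Section Smooth.
Context {K : numFieldType} {E F : tvsType K}.

(* Keller's theory needs directional derivatives between locally convex
   spaces, whereas the library's [derive] and [derivable] are stated for
   normed modules only; 0 is a junk value where the limit does not exist. *)
Definition is_dirder (f : E -> F) (x v : E) (l : F) : Prop :=
  (fun t : K => t^-1 *: (f (x + t *: v) - f x)) @ 0^' --> l.

Definition dirderivable (f : E -> F) (x v : E) : Prop :=
  exists l, is_dirder f x v l.

Definition dirder (f : E -> F) (v x : E) : F := xget 0 [set l | is_dirder f x v l].

(* D_(y (k-1)) (... (D_(y 0) f)) *)
Definition iter_dirder (f : E -> F) (k : nat) (y : 'I_k -> E) : E -> F :=
  foldl dirder f (codom y).

Definition smooth_on (U : set E) (f : E -> F) : Prop :=
  {within U, continuous f} /\
  forall k : nat,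
    (forall (y : 'I_k -> E) (v x : E), U x ->
       dirderivable (iter_dirder f y) x v) /\
    {within U `*` setT,
      continuous (fun p : E * {ptws 'I_k -> E} => iter_dirder f p.2 p.1)}.

End Smooth.

(* [chart_inv] is only meaningful on the image of [chart_dom]. *)
Record chart (K : numFieldType) (E : tvsType K) (M : topologicalType) := Chart {
  chart_dom : set M;
  chart_fun : M -> E;
  chart_inv : E -> M;
  chart_dom_open : open chart_dom;
  chart_img_open : open (chart_fun @` chart_dom);
  chart_funK : {in chart_dom, cancel chart_fun chart_inv};
  chart_fun_continuous : {within chart_dom, continuous chart_fun};
  chart_inv_continuous : {within chart_fun @` chart_dom, continuous chart_inv}
}.

Definition smooth_atlas (K : numFieldType) (E : tvsType K) (M : topologicalType)
    (A : set (chart E M)) : Prop :=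
  \bigcup_(c in A) chart_dom c = setT /\
  forall c d, A c -> A d ->
    smooth_on (chart_fun c @` (chart_dom c `&` chart_dom d))
              (chart_fun d \o chart_inv c).

Definition smooth_map (K : numFieldType) (E F : tvsType K)
    (M N : topologicalType) (A : set (chart E M)) (B : set (chart F N))
    (f : M -> N) : Prop :=
  continuous f /\
  forall c d, A c -> B d ->
    smooth_on (chart_fun c @` (chart_dom c `&` f @^-1` chart_dom d))
              (chart_fun d \o f \o chart_inv c).

Section ProductChart.
Context {K : numFieldType} {E F : tvsType K} {M N : topologicalType}.
Variables (c : chart E M) (d : chart F N).

Let dom := chart_dom c `*` chart_dom d.
Let fn := fun p : M * N => (chart_fun c p.1, chart_fun d p.2).
Let inv := fun q : E * F => (chart_inv c q.1, chart_inv d q.2).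

Let openXT (S T : topologicalType) (P : set S) (Q : set T) :
  open P -> open Q -> open (P `*` Q).
Proof.
rewrite !openE => oP oQ [x y] [/= Px Qy].
by exists (P, Q) => //=; split; [exact: oP|exact: oQ].
Qed.

Let pair_within (S S' T T' : topologicalType) (P : set S) (Q : set T)
    (f : S -> S') (g : T -> T') : open P -> open Q ->
  {within P, continuous f} -> {within Q, continuous g} ->
  {within P `*` Q, continuous (fun p : S * T => (f p.1, g p.2))}.
Proof.
move=> oP oQ; rewrite !continuous_open_subspace//; last exact: openXT.
move=> cf cg [x y] /[!inE] -[/= Px Qy].
apply: cvg_pair => /=.
  apply: (@cvg_comp _ _ _ fst f _ (nbhs x)); first exact: cvg_fst.
  by apply: cf; rewrite inE.
apply: (@cvg_comp _ _ _ snd g _ (nbhs y)); first exact: cvg_snd.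
by apply: cg; rewrite inE.
Qed.

Let imgE : fn @` dom =
  (chart_fun c @` chart_dom c) `*` (chart_fun d @` chart_dom d).
Proof.
apply/seteqP; split => [_ [[x y] [/= cx dy] <-]|[_ _] [/= [x cx <-] [y dy <-]]].
  by split; [exists x|exists y].
by exists (x, y).
Qed.

Lemma prod_chart_dom_open : open dom.
Proof. by apply: openXT; exact: chart_dom_open. Qed.

Lemma prod_chart_img_open : open (fn @` dom).
Proof. by rewrite imgE; apply: openXT; exact: chart_img_open. Qed.

Lemma prod_chart_funK : {in dom, cancel fn inv}.
Proof.
move=> [x y] /[!inE] -[/= cx dy].
by rewrite /inv /fn /= !chart_funK ?inE.
Qed.

Lemma prod_chart_fun_continuous : {within dom, continuous fn}.
Proof.
by apply: pair_within; [exact: chart_dom_open..|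
  exact: chart_fun_continuous|exact: chart_fun_continuous].
Qed.

Lemma prod_chart_inv_continuous : {within fn @` dom, continuous inv}.
Proof.
rewrite imgE; apply: pair_within; [exact: chart_img_open..|
  exact: chart_inv_continuous|exact: chart_inv_continuous].
Qed.

Definition prod_chart : chart (E * F)%type (M * N)%type :=
  Chart prod_chart_dom_open prod_chart_img_open prod_chart_funK
    prod_chart_fun_continuous prod_chart_inv_continuous.

End ProductChart.

Definition prod_atlas (K : numFieldType) (E F : tvsType K)
    (M N : topologicalType) (A : set (chart E M)) (B : set (chart F N)) :
    set (chart (E * F)%type (M * N)%type) :=
  [set prod_chart c d | c in A & d in B].

(* A group and a topology on the same carrier, not yet related. *)
#[short(type="preTopologicalGroupType")]
HB.structure Definition PreTopologicalGroup := {G of Topological G & Group G}.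

Definition lie_group (K : numFieldType) (E : tvsType K)
    (G : preTopologicalGroupType) (A : set (chart E G)) : Prop :=
  [/\ hausdorff_space G,
      smooth_atlas A,
      smooth_map (prod_atlas A A) A (fun p : G * G => (p.1 * p.2)%g)
    & smooth_map A A (fun x : G => x^-1%g)].

Definition left_entourage (G : preTopologicalGroupType) : set_system (G * G) :=
  [set P | exists2 U : set G, nbhs 1%g U &
     [set xy | U (xy.1^-1 * xy.2)%g] `<=` P].

(* The condition on [F] is the library's [cauchy], for the left uniformity. *)
Definition weil_complete (G : preTopologicalGroupType) : Prop :=
  forall F : set_system G, ProperFilter F ->
    (F, F) --> @left_entourage G -> exists x : G, F --> x.

(* Main.v *)
Require Import Defs.
From mathcomp Require Import all_boot all_order all_algebra.
From mathcomp Require Import all_classical all_reals all_analysis.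

(** The smooth structure plays no role beyond continuity of the
    multiplication: every topological group whose topology is $k_\omega$ is
    complete in its left uniformity.

    Let $F$ be a left Cauchy filter.  A cluster point of $F$ is a limit
    ([left_cauchy_cluster_cvg]), so suppose that there is none.  By compactness
    every compact $C$ then has a neighbourhood of the form $CU$ that misses a
    member of $F$ ([compact_avoids_filter]).  Let $(K_n)$ be the defining
    sequence of compact sets, put $L_n = K_n \cup \{1\}$ (so that $1 \in W$
    below), and choose open $U_n$ and $A_n \in F$ in this way for
    $C = K_n L_n$.  The decisive point is that $W = \bigcap_n L_n U_n$ is again
    a neighbourhood of $1$: an intersection of open sets $O_n \supseteq K_n$ is
    open in a $k_\omega$-space, because only
    finitely many of the $O_n$ constrain it inside a given $K_m$
    ([komega_bigcap_open]).  As $F$ is Cauchy, some member of $F$ lies in a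
    translate $aW$.  If $a \in K_m$, then $aW \subseteq K_m L_m U_m$ misses
    $A_m$, so that $F$ has two disjoint members, a contradiction. *)

Set Implicit Arguments.
Unset Strict Implicit.
Unset Printing Implicit Defensive.

Local Open Scope classical_set_scope.

(** The second hypothesis is the non-trivial half of the statement that
    [X] carries the direct limit topology; compactness of the [K n] is not
    needed. *)
Lemma komega_bigcap_open (X : topologicalType) (K : nat -> set X)
    (O : nat -> set X) :
  (forall n, K n `<=` K n.+1) ->
  (forall A : set X, (forall n, closed (A `&` K n : set (subspace (K n)))) ->
     closed A) ->
  (forall n, open (O n)) -> (forall n, K n `<=` O n) ->
  open (\bigcap_n O n).
Proof.
move=> Kincr Kclosed oO KO; rewrite -closedC; apply: Kclosed => m.
have Kle i j : (i <= j)%N -> K i `<=` K j.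
  move=> /subnK <-; elim: (j - i)%N => // k IHk; rewrite addSn.
  exact: subset_trans IHk (Kincr _).
have -> : ~` (\bigcap_n O n) `&` K m = \bigcup_(i in `I_m) (~` O i) `&` K m.
  apply/seteqP; split => x [Ox Kx]; split => //.
  - move: Ox; rewrite setC_bigcap => -[i _ nOx]; exists i => //=.
    by rewrite ltnNge; apply/negP => /Kle/(_ _ Kx)/KO.
  - by case: Ox => i _ nOx /(_ i Logic.I).
apply: closedI; last exact: closed_subspaceT.
apply: closed_subspaceW; apply: closed_bigcup => [|i _].
  exact: finite_II.
exact: open_closedC.
Qed.

Section LeftCauchyFilters.
Context {G : preTopologicalGroupType}
  (mul_continuous : continuous (fun p : G * G => (p.1 * p.2)%g)).
Implicit Types (F : set_system G) (C K L : set G).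

(** The Cauchy condition in iterated form: given a neighbourhood [W] of [1], the
    left translate [a W] belongs to [F] for all [a] in some member of [F]. *)
Lemma left_cauchy_near F (W : set G) : Filter F ->
  (F, F) --> @left_entourage G -> nbhs 1%g W ->
  \forall a \near F, \forall y \near F, W (a^-1 * y)%g.
Proof.
move=> FF cF W1.
have [|[P Q] /= [FP FQ] PQ] := cF [set xy | W (xy.1^-1 * xy.2)%g].
  by exists W.
by apply: filterS FP => a Pa; apply: filterS FQ => y Qy; exact: (PQ (a, y)).
Qed.

Lemma left_cauchy_cluster_cvg F x : ProperFilter F ->
  (F, F) --> @left_entourage G -> cluster F x -> F --> x.
Proof.
move=> FF cF clFx V Vx.
have [|[P W] /= [Px W1] PW] := mul_continuous (x := (x, 1%g)) (t := V).
  by rewrite /= mulg1.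
have [a [FWa Pa]] := clFx _ _ (left_cauchy_near _ cF W1) Px.
rewrite nbhs_filterE; apply: filterS FWa => y Wy.
by have := PW (a, a^-1 * y)%g (conj Pa Wy); rewrite /= mulVKg.
Qed.

(** If [F] has no cluster point, then a compact set [C] is separated from [F]
    uniformly in the group: [C U] misses [A] for some neighbourhood [U] of [1]
    and some [A] in [F]. *)
Lemma compact_avoids_filter F C : Filter F -> compact C ->
  (forall x, ~ cluster F x) ->
  exists U A, [/\ nbhs 1%g U, F A &
    forall c u, C c -> U u -> ~ A (c * u)%g].
Proof.
move=> FF /compact_near_coveringP cptC ncl.
have [|[U A] /= [U1 FA] UA] := cptC _ (filter_prod (nbhs (1%g : G)) F)
    (fun i c => (c * i.1)%g <> i.2).
  move=> x _; have /existsNP[A /existsNP[V]] := ncl x.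
  move=> /not_implyP[FA /not_implyP[Vx AV0]].
  have [|[P U] /= [Px U1] PU] := mul_continuous (x := (x, 1%g)) (t := V).
    by rewrite /= mulg1.
  exists (P, [set i | U i.1 /\ A i.2]) => /=.
    by split=> //; exists (U, A).
  move=> [c [u a]] /= [Pc [Uu Aa]] cua; apply: AV0; exists a; split=> //.
  by rewrite -cua; exact: (PU (c, u)).
exists U, A; split=> // c u Cc Uu Acu.
exact: (UA (u, c * u)%g (conj Uu Acu) c Cc).
Qed.

Lemma mulg_set_open L (U : set G) : open U ->
  open (\bigcup_(k in L) [set x | U (k^-1 * x)%g]).
Proof.
move=> oU; apply: bigcup_open => k _; apply: open_comp => // x _.
apply: (@continuous_comp _ _ _ (fun x : G => (k^-1%g, x))
  (fun p => (p.1 * p.2)%g)); last exact: mul_continuous.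
by apply: cvg_pair; [exact: cvg_cst|exact: cvg_id].
Qed.

Lemma compact_mulg K L : compact K -> compact L ->
  compact [set (p.1 * p.2)%g | p in K `*` L].
Proof.
move=> cK cL; apply: continuous_compact; last exact: compact_setX.
exact: continuous_subspaceT.
Qed.

Theorem komega_group_weil_complete : komega_space G -> weil_complete G.
Proof.
move=> [_ [K [cptK Kincr Kcover Kclosed]]] F FF cF.
have [[x clFx]|ncl] := pselect (exists x, cluster F x).
  by exists x; exact: left_cauchy_cluster_cvg.
exfalso; pose L n := K n `|` [set 1%g].
have cptKL n : compact [set (p.1 * p.2)%g | p in K n `*` L n].
  by apply: compact_mulg => //; apply: compactU => //; exact: compact_set1.
have /choice[U /choice[A UA]] n :=
  compact_avoids_filter FF (cptKL n) ((forallNP _).2 ncl).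
pose O n := \bigcup_(k in L n) [set x | (U n)° (k^-1 * x)%g].
have LO n : L n `<=` O n.
  move=> k Lk; exists k => //=; rewrite mulVg.
  by have [] := UA n.
have oW : open (\bigcap_n O n).
  apply: (komega_bigcap_open Kincr) => [B|n|n]; first by move/Kclosed.
    by apply: mulg_set_open; exact: open_interior.
  by move=> x Kx; apply: LO; left.
have W1 : nbhs 1%g (\bigcap_n O n).
  by apply: open_nbhs_nbhs; split=> // n _; apply: LO; right.
have [a FaW] := filter_ex (left_cauchy_near _ cF W1).
have [m _ Kma] : (\bigcup_n K n) a by rewrite Kcover.
have [_ FA UAm] := UA m.
have [y [aWy Amy]] := filter_ex (filterI FaW FA).
(* Only the m-th factor of W is used: y = a k u with a \in K_m, k \in L_m. *)
have [k Lk /interior_subset Uu] := aWy m Logic.I.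
apply: (UAm (a * k)%g _ _ Uu); first by exists (a, k).
by rewrite -mulgA mulVKg mulVKg.
Qed.

End LeftCauchyFilters.

Theorem corollary1p3 (R : realType) (s : scalar_kind)
    (E : tvsType (scalars R s)) (hE : hausdorff_space E)
    (G : preTopologicalGroupType) (A : set (chart E G))
    (hG : lie_group A) (kG : komega_space G) :
  weil_complete G.
Proof.
have [_ _ [mul_continuous _] _] := hG.
exact: komega_group_weil_complete.
Qed.
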